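(* Let $A_n$ be a finite alphabet with $n\ge2$ letters. Then there is an isomorphism between the $n$-ary Cantor algebra $(\mathscr{T}_n,\alpha_1,\dots,\alpha_n,\lambda)$ and Higman's $n$-ary Cantor algebra of standard forms over the set $\{x\}$. In particular, the standard symbols of $\mathscr{T}_n$ are in bijective correspondence with the standard forms over the set $\{x\}$.
   Context: An $n$-ary Cantor algebra is a structure $(X,\alpha_1,\dots,\alpha_n,\lambda)$, where the $\alpha_i$ are unary operations and $\lambda$ is an $n$-ary operation on $X$ (operations written to the right of their arguments), satisfying: (CA1) $(x\alpha_1,\dots,x\alpha_n)\lambda=x$ for all $x\in X$; (CA2) $(x_1,\dots,x_n)\lambda\alpha_i=x_i$ for all $x_1,\dots,x_n\in X$ and $1\le i\le n$. $A_n=\{a_1,\dots,a_n\}$; $A_n^{*}$ is the free monoid, $A_n^{\omega}$ the Cantor space of right-infinite strings. A finite subset of $A_n^{*}$ is a prefix code if no element is a prefix of a different element; it is a maximal prefix code if moreover every string in $A_n^{*}$ is a prefix of, or has as a prefix, some element of it. A symbol $\left(\frac{X}{Y}\right)$ consists of a prefix code $X=\{x_1,\dots,x_m\}$ and a matching list $Y$ of strings $y_1,\dots,y_m\in A_n^{*}$ (repetitions allowed, $x_i$ matched with $y_i$); it determines the partial function on $A_n^{\omega}$ given by $x_iw\mapsto y_iw$ on the domain $XA_n^{\omega}$. $\mathscr{T}_n$ is the monoid of all total maps $A_n^{\omega}\to A_n^{\omega}$ determined by symbols with $X$ a maximal prefix code. For $a\in A_n$ let $\rho_a:A_n^{\omega}\to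 aA_n^{\omega}$, $w\mapsto aw$. The operations on $\mathscr{T}_n$ are $(f)\alpha_i=f\rho_{a_i}$ and $(f_1,\dots,f_n)\lambda=f_1\rho_{a_1}^{-1}\cup\dots\cup f_n\rho_{a_n}^{-1}$ (composition with the right-hand factor applied first). A symbol $\left(\frac{X}{Y}\right)$ can be simplified if there are strings $u,y$ such that $ua_1,\dots,ua_n\in X$ and $ua_i$ is matched with $ya_i$ for each $1\le i\le n$ (one may then replace these $n$ matched pairs by the single matched pair $u$, $y$, which does not change the induced function). A standard symbol is a symbol $\left(\frac{X}{Y}\right)$ with $X$ a maximal prefix code which cannot be simplified. Symbols are identified if they consist of the same set of matched pairs. Higman's algebra of standard forms over $\{x\}$, where $x$ is a letter not in $A_n$: standard forms are formal expressions defined inductively as follows. Every expression $x\alpha_{i_1}\cdots\alpha_{i_k}$ with $k\ge0$ is a standard form; if $u_1,\dots,u_n$ are standard forms and there is no expression $u=x\alpha_{i_1}\cdots\alpha_{i_k}$ with $u_i=u\alpha_i$ for all $1\le i\le n$, then the formal expression $(u_1,\dots,u_n)\lambda$ is a standard form; there are no others. The operations are: $\alpha_i$ applied to $x\alpha_{i_1}\cdots\alpha_{i_k}$ gives $x\alpha_{i_1}\cdots\alpha_{i_k}\alpha_i$; $\alpha_i$ applied to a standard form $(u_1,\dots,u_n)\lambda$ gives $u_i$; and $\lambda$ applied to $(u_1,\dots,u_n)$ gives $u$ if there is some $u=x\alpha_{i_1}\cdots\alpha_{i_k}$ with $u_i=u\alpha_i$ for all $i$, and otherwise gives the standard form $(u_1,\dots,u_n)\lambda$.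 *)

(* Defs.v *)
From mathcomp Require Import all_boot finmap.
From mathcomp Require Import boolp.
Set Implicit Arguments. Unset Strict Implicit. Unset Printing Implicit Defensive.

Local Open Scope fset_scope.
Local Open Scope fmap_scope.
Local Open Scope nat_scope.

Record cantor_algebra (n : nat) := CantorAlgebra {
  ca_sort :> Type;
  ca_alpha : 'I_n -> ca_sort -> ca_sort;
  ca_lambda : {ffun 'I_n -> ca_sort} -> ca_sort;
  ca_CA1 : forall x, ca_lambda [ffun i => ca_alpha i x] = x;
  ca_CA2 : forall (xs : {ffun 'I_n -> ca_sort}) i,
    ca_alpha i (ca_lambda xs) = xs i }.

Definition cantor_isomorphism n (X Y : cantor_algebra n) (phi : X -> Y) :=
  [/\ bijective phi,
      forall i x, phi (ca_alpha i x) = ca_alpha i (phi x) &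
      forall xs, phi (ca_lambda xs) = ca_lambda [ffun i => phi (xs i)]].

Lemma sig_inj (A : Type) (P : A -> Prop) (s t : {x : A | P x}) :
  proj1_sig s = proj1_sig t -> s = t.
Proof. by case: s t => [s ps] [t pt] /= e; apply: eq_exist. Qed.

Section Strings.
Variable n : nat.

Definition string := seq 'I_n.
Definition omega_string := nat -> 'I_n.

Definition ocons (a : 'I_n) (w : omega_string) : omega_string :=
  fun k => if k is k'.+1 then w k' else a.

Definition ocat (x : string) (w : omega_string) : omega_string :=
  foldr ocons w x.

Definition odrop (k : nat) (w : omega_string) : omega_string :=
  fun j => w (k + j).

Definition prefix_code (X : {fset string}) :=
  forall x y, x \in X -> y \in X -> prefix x y -> x = y.

Definition maximal_prefix_code (X : {fset string}) :=
  prefix_code X /\ forall u, exists2 x, x \in X & prefix u x || prefix x u.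

(* A symbol is the finite map sending each element of X to the string matched *)
(* with it; two such maps are equal iff they have the same matched pairs.     *)
Definition symbol := {fmap string -> string}.

Definition symbol_graph (S : symbol) (v v' : omega_string) :=
  exists x y w, [/\ S.[? x] = Some y, v = ocat x w & v' = ocat y w].

Definition determines (S : symbol) (f : omega_string -> omega_string) :=
  forall v v', f v = v' <-> symbol_graph S v v'.

Definition in_T (f : omega_string -> omega_string) :=
  exists2 S : symbol, maximal_prefix_code (domf S) & determines S f.

Definition T := {f : omega_string -> omega_string | in_T f}.

Definition simplifiable (S : symbol) :=
  exists u y : string, forall i, S.[? rcons u i] = Some (rcons y i).

Definition standard_symbol :=
  {S : symbol | maximal_prefix_code (domf S) /\ ~ simplifiable S}.

Lemma ocat_cat x y w : ocat (x ++ y) w = ocat x (ocat y w).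
Proof. by rewrite /ocat foldr_cat. Qed.

Lemma ocatE x w k : ocat x w k = if k < size x then nth (w 0) x k else w (k - size x).
Proof.
by elim: x k => [|a x IH] [|k] //=.
Qed.

Lemma ocat_inj x : injective (ocat x).
Proof.
move=> w w' e; apply/funext => k; have := congr1 (fun g => g (size x + k)) e.
by rewrite !ocatE ltnNge leq_addr /= addKn.
Qed.

Lemma mkseq_ocat v k : ocat (mkseq v k) (odrop k v) = v.
Proof.
apply/funext => j; rewrite ocatE size_mkseq; case: ltnP => h.
  by rewrite nth_mkseq.
by rewrite /odrop subnKC.
Qed.

Lemma ocons_odrop v : ocons (v 0) (odrop 1 v) = v.
Proof. exact: (mkseq_ocat v 1). Qed.

Lemma ocat_eq_prefix x y w w' :
  ocat x w = ocat y w' -> size x <= size y -> prefix x y.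
Proof.
move=> e h; rewrite prefixE; apply/eqP.
apply: (@eq_from_nth _ (w 0)); first by rewrite size_takel.
move=> i; rewrite size_takel // => hi; rewrite nth_take //.
have := congr1 (fun g => g i) e; rewrite !ocatE hi (leq_trans hi h) => ->.
by apply: set_nth_default; apply: leq_trans h.
Qed.

Lemma symbol_size_bound (S : symbol) :
  exists L, forall x, x \in domf S -> size x <= L.
Proof.
exists (\max_(x <- domf S) size x) => x xS.
by rewrite (big_rem x) //= leq_maxl.
Qed.

Lemma maximal_prefix_code_cover (S : symbol) L u :
  maximal_prefix_code (domf S) -> (forall x, x \in domf S -> size x <= L) ->
  size u = L -> exists x y z, S.[? x] = Some y /\ u = x ++ z.
Proof.
move=> [_ hm] hL hu; have [x xS] := hm u.
case/orP => [/prefixP[z e]|/prefixP[z ->]]; last by exists x, S.[xS], z; rewrite in_fnd.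
have z0 : z = [::].
  move: (hL x xS); rewrite e size_cat hu -[X in _ <= X]addn0 leq_add2l leqn0.
  by move/nilP.
by exists x, S.[xS], [::]; rewrite in_fnd cats0; split=> //; move: e; rewrite z0 cats0.
Qed.

Lemma symbol_graph_total (S : symbol) : maximal_prefix_code (domf S) ->
  forall v, exists v', symbol_graph S v v'.
Proof.
move=> hm v; have [L hL] := symbol_size_bound S.
have [x [y [z [e eu]]]] := maximal_prefix_code_cover hm hL (size_mkseq v L).
exists (ocat y (ocat z (odrop L v))), x, y, (ocat z (odrop L v)); split=> //.
by rewrite -ocat_cat -eu mkseq_ocat.
Qed.

Lemma symbol_graph_functional (S : symbol) : prefix_code (domf S) ->
  forall v v1 v2, symbol_graph S v v1 -> symbol_graph S v v2 -> v1 = v2.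
Proof.
move=> hp v v1 v2 [x [y [w [e -> ->]]]] [x' [y' [w' [e' ee ->]]]].
have xS : x \in domf S by rewrite -fndSome e.
have xS' : x' \in domf S by rewrite -fndSome e'.
have exx : x = x'.
  case: (leqP (size x) (size x')) => h.
    exact: hp (ocat_eq_prefix ee h).
  by apply/esym; apply: hp (ocat_eq_prefix (esym ee) (ltnW h)).
by move: e ee; rewrite exx e' => -[->] /ocat_inj ->.
Qed.

Definition symbol_fun (S : symbol) (hS : maximal_prefix_code (domf S)) :
    omega_string -> omega_string :=
  fun v => projT1 (cid (symbol_graph_total hS v)).

Lemma symbol_funP S hS : determines S (@symbol_fun S hS).
Proof.
move=> v v'; rewrite /symbol_fun; case: cid => u /= hu; split => [<- //|].
exact: symbol_graph_functional hS.1 _ _ _ hu.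
Qed.

Lemma symbol_fun_in_T S hS : in_T (@symbol_fun S hS).
Proof. by exists S => //; apply: symbol_funP. Qed.

Definition standard_symbol_map (S : standard_symbol) : T :=
  exist _ _ (symbol_fun_in_T (proj1 (proj2_sig S))).

Definition T_alpha_fun (i : 'I_n) (f : omega_string -> omega_string) :=
  f \o ocons i.

Definition T_lambda_fun (fs : 'I_n -> omega_string -> omega_string) :
    omega_string -> omega_string :=
  fun v => fs (v 0) (odrop 1 v).

(* The graph of T_lambda_fun is the union of the graphs of the f_i rho_i^-1.  *)
Lemma T_lambda_funP fs v v' :
  T_lambda_fun fs v = v' <-> exists i w, v = ocons i w /\ v' = fs i w.
Proof.
split=> [<-|[i [w [-> ->]]]] //.
by exists (v 0), (odrop 1 v); split => //; rewrite ocons_odrop.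
Qed.

Definition uniform_depth (f : omega_string -> omega_string) L :=
  forall x, size x = L -> exists y, forall w, f (ocat x w) = ocat y w.

Lemma uniform_depthW f L M : L <= M -> uniform_depth f L -> uniform_depth f M.
Proof.
move=> hLM hf x hx; have [|y hy] := hf (take L x).
  by rewrite size_takel // hx.
exists (y ++ drop L x) => w.
by rewrite -{1}(cat_take_drop L x) !ocat_cat hy.
Qed.

Lemma in_T_uniform_depth f : in_T f -> exists L, uniform_depth f L.
Proof.
move=> [S hS hf]; have [L hL] := symbol_size_bound S; exists L => u hu.
have [x [y [z [e ->]]]] := maximal_prefix_code_cover hS hL hu.
exists (y ++ z) => w; apply/hf; exists x, y, (ocat z w).
by rewrite !ocat_cat.
Qed.

Hypothesis n_gt1 : 1 < n.

Lemma uniform_depth_in_T f L : uniform_depth f L -> in_T f.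
Proof.
move=> hf; pose X := [fset x in [seq val t | t <- enum {: L.-tuple 'I_n}]].
have inX x : (x \in X) = (size x == L).
  rewrite in_fset /=; apply/mapP/idP => [[t _ ->]|hx].
    by rewrite size_tuple.
  by exists (Tuple hx); rewrite ?mem_enum.
have yP (x : X) : exists y, forall w, f (ocat (val x) w) = ocat y w.
  by apply: hf; apply/eqP; rewrite -inX (valP x).
pose S : symbol := [fmap x : X => projT1 (cid (yP x))].
have hX : maximal_prefix_code (domf S).
  split=> [x y|u] /=.
    rewrite !inX => /eqP hx /eqP hy; rewrite prefixE => /eqP <-.
    by rewrite hx -hy take_size.
  have a := Ordinal (ltnW n_gt1).
  exists (take L (u ++ nseq L a)).
    by rewrite inX size_takel // size_cat size_nseq leq_addl.
  rewrite take_cat; case: ltnP => h; last by rewrite prefix_prefix.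
  by rewrite (prefix_take u L) orbT.
exists S => // v v'.
have hfS x y : S.[? x] = Some y -> forall w, f (ocat x w) = ocat y w.
  move=> e w; have xS : x \in domf S by rewrite -fndSome e.
  move: e; rewrite in_fnd ffunE => -[<-]; case: cid => z /= hz; exact: hz.
split=> [<-|[x [y [w [e -> ->]]]]]; last exact: hfS.
have [v1 [x [y [w [e -> _]]]]] := symbol_graph_total hX v.
by exists x, y, w; split=> //; apply: hfS.
Qed.

Lemma T_alpha_subproof i f : in_T f -> in_T (T_alpha_fun i f).
Proof.
move=> /in_T_uniform_depth [L hL]; apply: (@uniform_depth_in_T _ L) => x hx.
by have [|y hy] := uniform_depthW (leqnSn L) hL (x := i :: x);
  [rewrite /= hx | exists y => w; apply: hy].
Qed.

Lemma T_lambda_subproof fs : (forall i, in_T (fs i)) -> in_T (T_lambda_fun fs).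
Proof.
move=> hfs; have hL i := cid (in_T_uniform_depth (hfs i)).
pose M := \max_i projT1 (hL i).
apply: (@uniform_depth_in_T _ M.+1) => -[//|i x] [hx].
have [|y hy] := @uniform_depthW (fs i) (projT1 (hL i)) M _ (projT2 (hL i)) x hx.
  exact: leq_bigmax.
by exists y => w; rewrite -hy.
Qed.

Definition T_alpha (i : 'I_n) (f : T) : T :=
  exist _ _ (T_alpha_subproof i (proj2_sig f)).

Definition T_lambda (fs : {ffun 'I_n -> T}) : T :=
  exist _ _ (T_lambda_subproof (fun i => proj2_sig (fs i))).

Lemma T_CA1 f : T_lambda [ffun i => T_alpha i f] = f.
Proof.
apply: sig_inj; apply/funext => v /=.
by rewrite /T_lambda_fun ffunE /= /T_alpha_fun /= ocons_odrop.
Qed.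

Lemma T_CA2 fs i : T_alpha i (T_lambda fs) = fs i.
Proof. by apply: sig_inj; apply/funext. Qed.

Definition T_cantor_algebra := CantorAlgebra T_CA1 T_CA2.

Inductive term :=
  | Gen
  | Alpha of 'I_n & term
  | Lambda of {ffun 'I_n -> term}.

(* word [:: i1; ...; ik] is the expression x alpha_i1 ... alpha_ik *)
Definition word (s : string) : term := foldl (fun t i => Alpha i t) Gen s.

Definition is_family_of (us : {ffun 'I_n -> term}) (s : string) :=
  forall i, us i = Alpha i (word s).

Inductive is_standard_form : term -> Prop :=
  | std_word (s : string) : is_standard_form (word s)
  | std_Lambda (us : {ffun 'I_n -> term}) : (forall i, is_standard_form (us i)) ->
      ~ (exists s, is_family_of us s) -> is_standard_form (Lambda us).

Definition standard_form := {t : term | is_standard_form t}.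

Definition term_alpha (i : 'I_n) (t : term) : term :=
  if t is Lambda us then us i else Alpha i t.

Definition term_lambda (us : {ffun 'I_n -> term}) : term :=
  if pselect (exists s, is_family_of us s) is left h then word (projT1 (cid h))
  else Lambda us.

Lemma word_rcons s i : word (rcons s i) = Alpha i (word s).
Proof. by rewrite /word foldl_rcons. Qed.

Lemma term_alpha_word i s : term_alpha i (word s) = Alpha i (word s).
Proof. by case/lastP: s => // s j; rewrite word_rcons. Qed.

Lemma std_alpha_subproof i t :
  is_standard_form t -> is_standard_form (term_alpha i t).
Proof.
by case=> [s|us hus _]; [rewrite term_alpha_word -word_rcons; left | apply: hus].
Qed.

Lemma std_lambda_subproof (us : {ffun 'I_n -> term}) :
  (forall i, is_standard_form (us i)) -> is_standard_form (term_lambda us).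
Proof.
by rewrite /term_lambda => h; case: pselect => hs; [left | right].
Qed.

Definition std_alpha (i : 'I_n) (t : standard_form) : standard_form :=
  exist _ _ (std_alpha_subproof i (proj2_sig t)).

Lemma std_family_subproof (us : {ffun 'I_n -> standard_form}) i :
  is_standard_form ([ffun j => proj1_sig (us j)] i).
Proof. by rewrite ffunE; apply: (proj2_sig (us i)). Qed.

Definition std_lambda (us : {ffun 'I_n -> standard_form}) : standard_form :=
  exist _ _ (std_lambda_subproof (std_family_subproof us)).

Lemma std_CA1 t : std_lambda [ffun i => std_alpha i t] = t.
Proof.
apply: sig_inj => /=; case: t => t /= ht.
set us := finfun _; have usE i : us i = term_alpha i t by rewrite !ffunE.
rewrite /term_lambda; case: ht us usE => [s|vs hvs nvs] us usE.
  case: pselect => [h|[]]; last by exists s => i; rewrite usE term_alpha_word.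
  case: cid => s' /= /(_ (Ordinal (ltnW n_gt1))).
  by rewrite usE term_alpha_word => -[].
have -> : us = vs by apply/ffunP => i; rewrite usE.
by case: pselect.
Qed.

Lemma std_CA2 us i : std_alpha i (std_lambda us) = us i.
Proof.
apply: sig_inj => /=; rewrite /term_lambda.
case: pselect => [h|_] /=; last by rewrite ffunE.
by case: cid => s /= hs; rewrite term_alpha_word -hs ffunE.
Qed.

Definition standard_form_cantor_algebra := CantorAlgebra std_CA1 std_CA2.

End Strings.

(* Main.v *)
(* Evaluating a formal expression at x = id gives a homomorphism from standard
   forms to T. It is surjective by induction on a depth at which f acts letter
   by letter. For symbols: the pairs (x, y) such that f (x w) = y w for all w
   and x is prefix-minimal with this property form the only symbol of f which
   cannot be simplified. *)
Require Import Defs.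
From mathcomp Require Import all_boot.
From mathcomp Require Import finmap boolp.
Set Implicit Arguments. Unset Strict Implicit. Unset Printing Implicit Defensive.

Local Open Scope fset_scope.
Local Open Scope fmap_scope.
Local Open Scope nat_scope.

(** * Bijections and prefixes *)

Lemma inj_surj_bijective (A B : Type) (f : A -> B) :
  injective f -> (forall b, exists a, f a = b) -> bijective f.
Proof.
move=> f_inj f_surj; exists (fun b => projT1 (cid (f_surj b))) => [a|b].
  by apply: f_inj; case: cid.
by case: cid.
Qed.

Lemma prefix_comparable (A : eqType) (x y z : seq A) :
  prefix x z -> prefix y z -> size x <= size y -> prefix x y.
Proof.
by rewrite !prefixE => /eqP hx /eqP hy h; rewrite -hy take_takel // hx.
Qed.

Lemma prefix_rconsE (A : eqType) (x y : seq A) a :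
  prefix x (rcons y a) = prefix x y || (x == rcons y a).
Proof.
apply/idP/orP => [h|[h|/eqP->]]; last exact: prefix_refl.
- have := size_prefix h; rewrite size_rcons leq_eqVlt => /predU1P[e|hs].
    by right; move: h; rewrite prefixE e -(size_rcons y a) take_size eq_sym.
  by left; apply: prefix_comparable h (prefix_rcons _ _) _.
- exact: prefix_trans h (prefix_rcons _ _).
Qed.

Section Evaluation.
Variables (n : nat) (n_gt1 : 1 < n).

Lemma ord_other (a : 'I_n) : exists b, b != a.
Proof.
have n_gt0 := ltnW n_gt1.
have [e|h] := eqVneq (Ordinal n_gt0) a; last by exists (Ordinal n_gt0).
by exists (Ordinal n_gt1); rewrite -e.
Qed.

(** If [y] properly extends [x], its next letter [a] is refuted by the constant string of a letter
    other than [a], which exists since [1 < n]. *)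
Lemma ocat_left_inj (x y : string n) : (forall w, ocat x w = ocat y w) -> x = y.
Proof.
wlog h : x y / size x <= size y => [hw e|e].
  case: (leqP (size x) (size y)) => h; first exact: hw.
  by apply/esym/hw => [|w]; rewrite ?e // ltnW.
have w0 : omega_string n by move=> _; apply: Ordinal n_gt1.
have /prefixP[z ey] := ocat_eq_prefix (e w0) h.
case: z ey => [|a z] ey; first by rewrite ey cats0.
have [b hb] := ord_other a.
have /ocat_inj/(congr1 (fun v => v 0)) /= eb :
  ocat x (fun=> b) = ocat x (ocat (a :: z) (fun=> b)) by rewrite -ocat_cat -ey e.
by rewrite eb eqxx in hb.
Qed.

(** * Evaluation of standard forms at the identity *)

Fixpoint term_fun (t : term n) : omega_string n -> omega_string n :=
  match t with
  | Gen => id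
  | Alpha i t => T_alpha_fun i (term_fun t)
  | Lambda us => T_lambda_fun (fun i => term_fun (us i))
  end.

Lemma term_fun_word s : term_fun (word s) = ocat s.
Proof.
elim/last_ind: s => [|s i IH] //; rewrite word_rcons /= IH.
by apply/funext => w; rewrite -cats1 ocat_cat.
Qed.

Lemma T_lambda_alpha_fun (f : omega_string n -> omega_string n) :
  T_lambda_fun (fun i => T_alpha_fun i f) = f.
Proof.
by apply/funext => v; rewrite /T_lambda_fun /T_alpha_fun /= ocons_odrop.
Qed.

Lemma T_alpha_lambda_fun i (fs : 'I_n -> omega_string n -> omega_string n) :
  T_alpha_fun i (T_lambda_fun fs) = fs i.
Proof. by apply/funext. Qed.

Lemma term_fun_alpha i t :
  term_fun (term_alpha i t) = T_alpha_fun i (term_fun t).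
Proof. by case: t => // us; rewrite /= T_alpha_lambda_fun. Qed.

(** Collapsing a family [u alpha_i] to [u] preserves the value, because a map is glued from its
    restrictions to the cones of single letters. *)
Lemma term_fun_lambda us :
  term_fun (term_lambda us) = T_lambda_fun (fun i => term_fun (us i)).
Proof.
rewrite /term_lambda; case: pselect => // h; case: cid => s /= hs.
rewrite -[LHS]T_lambda_alpha_fun; congr T_lambda_fun.
by apply/funext => i; rewrite hs.
Qed.

Lemma term_fun_in_T t : is_standard_form t -> in_T (term_fun t).
Proof.
elim=> [s|us _ IH _]; last exact: T_lambda_subproof.
rewrite term_fun_word; apply: (@uniform_depth_in_T _ n_gt1 _ 0) => x _.
by exists (s ++ x) => w; rewrite ocat_cat.
Qed.

(** If a [Lambda] evaluated to [ocat s], its components would by induction be the words [rcons s i],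
    the family that standardness excludes. *)
Lemma term_fun_eq_word t s :
  is_standard_form t -> term_fun t = ocat s -> t = word s.
Proof.
move=> ht; elim: ht s => [s' s|us _ IH nfam s e].
  by rewrite term_fun_word => e; rewrite (@ocat_left_inj s' s) // e.
case: nfam; exists s => i; rewrite -word_rcons; apply: IH.
rewrite -(T_alpha_lambda_fun i (fun i => term_fun (us i))).
rewrite -[T_lambda_fun _]/(term_fun (Lambda us)) e.
by apply/funext => w; rewrite -cats1 ocat_cat.
Qed.

Lemma term_fun_inj t t' : is_standard_form t -> is_standard_form t' ->
  term_fun t = term_fun t' -> t = t'.
Proof.
move=> ht; elim: ht t' => [s t' ht'|us hus IH nfam t' ht'].
  by rewrite term_fun_word => /esym /(term_fun_eq_word ht').
case: ht' => [s|vs hvs _ e].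
  by rewrite term_fun_word; apply/term_fun_eq_word/std_Lambda.
congr Lambda; apply/ffunP => i; apply: IH => //.
have := congr1 (T_alpha_fun i) e.
by rewrite /= !T_alpha_lambda_fun.
Qed.

Lemma term_fun_surj f :
  in_T f -> exists2 t, is_standard_form t & term_fun t = f.
Proof.
move=> /in_T_uniform_depth[L]; elim: L f => [|L IH] f hf.
  have [y hy] := hf [::] erefl; exists (word y); first exact: std_word.
  by rewrite term_fun_word; apply/funext => w; rewrite -hy.
have hi i : exists2 t, is_standard_form t & term_fun t = T_alpha_fun i f.
  (* Restricting to the cone of [i] uses up one letter of depth. *)
  by apply: IH => x hx; have [|y hy] := hf (i :: x); [rewrite /= hx | exists y].
have [us hus] : exists us : {ffun 'I_n -> term n}, forall i,
    is_standard_form (us i) /\ term_fun (us i) = T_alpha_fun i f.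
  by exists [ffun i => s2val (cid2 (hi i))] => i; rewrite ffunE; case: cid2.
(* The constructor [Lambda] would not do: the chosen [us] may be a family that collapses. *)
exists (term_lambda us); first by apply: std_lambda_subproof => i; case: (hus i).
rewrite term_fun_lambda -[RHS]T_lambda_alpha_fun; congr T_lambda_fun.
by apply/funext => i; case: (hus i).
Qed.

Definition std_fun (t : standard_form_cantor_algebra n_gt1) :
    T_cantor_algebra n_gt1 :=
  exist _ _ (term_fun_in_T (proj2_sig t)).

Lemma std_fun_bij : bijective std_fun.
Proof.
apply: inj_surj_bijective => [t t' /(congr1 (@proj1_sig _ _)) /= e|[f hf]].
  by apply/sig_inj/term_fun_inj => //; apply: (proj2_sig _).
have [t ht e] := term_fun_surj hf.
by exists (exist _ t ht); apply: sig_inj.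
Qed.

Lemma std_fun_alpha i t : std_fun (ca_alpha i t) = ca_alpha i (std_fun t).
Proof. by apply: sig_inj; rewrite /= term_fun_alpha. Qed.

Lemma std_fun_lambda us :
  std_fun (ca_lambda us) = ca_lambda [ffun i => std_fun (us i)].
Proof.
apply: sig_inj; rewrite /= term_fun_lambda; congr T_lambda_fun.
by apply/funext => i; rewrite !ffunE.
Qed.

Lemma cantor_isomorphism_inverse (X Y : cantor_algebra n)
    (f : X -> Y) (g : Y -> X) : cancel f g -> cancel g f ->
  cantor_isomorphism f -> cantor_isomorphism g.
Proof.
move=> fK gK [_ falpha flambda]; split=> [|i y|ys].
- by exists f.
- by rewrite -{1}[y]gK -falpha fK.
- rewrite -[RHS]fK flambda; congr (g (ca_lambda _)).
  by apply/ffunP => i; rewrite !ffunE gK.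
Qed.

(** * Maximal cones and symbols that cannot be simplified *)

Definition cone_map (f : omega_string n -> omega_string n) (x y : string n) :=
  forall w, f (ocat x w) = ocat y w.

(** Shorter strings span larger cones, so maximality of the cone is prefix-minimality of [x]. *)
Definition maximal_cone f x y :=
  cone_map f x y /\
  forall x' y', cone_map f x' y' -> prefix x' x -> x' = x.

Lemma cone_map_functional f x y y' :
  cone_map f x y -> cone_map f x y' -> y = y'.
Proof. by move=> h h'; apply: ocat_left_inj => w; rewrite -h h'. Qed.

Lemma cone_map_cat f x y z : cone_map f x y -> cone_map f (x ++ z) (y ++ z).
Proof. by move=> h w; rewrite !ocat_cat h. Qed.

Lemma maximal_cone_exists f x y : cone_map f x y ->
  exists x' y', prefix x' x /\ maximal_cone f x' y'.
Proof.
have [k] := ubnP (size x); elim: k x y => // k IH x y hk hxy.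
case: (pselect (exists x' y', [/\ cone_map f x' y', prefix x' x & x' <> x])).
  move=> [x' [y' [hf /prefixP[z ez] nx]]].
  have [|x2 [y2 [p2 m2]]] := IH x' y' _ hf.
    move: hk; rewrite ez size_cat; case: z ez => [|a z] ez.
      by case: nx; rewrite ez cats0.
    by rewrite /= addnS ltnS => /(leq_ltn_trans _); apply; rewrite leq_addr.
  exists x2, y2; split=> //; apply: prefix_trans p2 _.
  by rewrite ez prefix_prefix.
move=> nmax; exists x, y; split; first exact: prefix_refl.
split=> // x' y' hf hp; apply: contrapT => nx.
by apply: nmax; exists x', y'.
Qed.

(** The cones of a maximal prefix code cover the Cantor space, so checking [f] on each matched pair
    suffices. *)
Lemma determinesP (S : symbol n) f : maximal_prefix_code (domf S) ->
  determines S f <-> forall x y, S.[? x] = Some y -> cone_map f x y.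
Proof.
move=> hS; split=> [hf x y e w|hf v v']; first by apply/hf; exists x, y, w.
split=> [<-|[x [y [w [e -> ->]]]]]; last exact: hf.
have [v1 [x [y [w [e -> _]]]]] := symbol_graph_total hS v.
by exists x, y, w; split=> //; apply: hf.
Qed.

(* If x were not minimal, a longest element z = ua of the code extending a
   shorter x' would have all its siblings ub in the code; as f replaces
   the prefix x' by a fixed y', these n pairs can be merged. *)
Lemma unsimplifiable_maximal_cone (S : symbol n) f x y :
  maximal_prefix_code (domf S) -> ~ simplifiable S -> determines S f ->
  S.[? x] = Some y -> maximal_cone f x y.
Proof.
move=> hS nsimp /(determinesP f hS) hf Sx.
have xS : x \in domf S by rewrite -fndSome Sx.
split=> [|x' y' hx' px']; first exact: hf.
apply: contrapT => nx; apply: nsimp.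
have [z hz zmax] := arg_maxnP (P := fun z : domf S => prefix x' (val z))
  (fun z => size (val z)) (i0 := [` xS]) px'.
have {}zmax t : t \in domf S -> prefix x' t -> size t <= size (val z).
  by move=> tS; apply: (zmax [` tS]).
case: z hz zmax => /= z; case/lastP: z => [|u a] zS hz zmax.
  move: hz; rewrite prefixs0 => /eqP ex'.
  by case: nx; rewrite ex'; apply: hS.1 => //; rewrite prefix0s.
have {hz} /prefixP[v eu] : prefix x' u.
  move: hz; rewrite prefix_rconsE => /orP[//|/eqP e].
  by case: nx; apply: hS.1 => //; rewrite e.
(* Since [u = x' ++ v], the map [f] replaces [u] by [y' ++ v]. *)
exists u, (y' ++ v) => b.
have ubS : rcons u b \in domf S.
  (* A code element [t] extending [rcons u b] equals it, as [z] is longest; a proper prefix of it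
     would also be a prefix of [rcons u a], against the code property. *)
  have [t tS] := hS.2 (rcons u b); case/orP => ht.
    have /zmax : prefix x' t.
      apply: prefix_trans ht; apply: prefix_trans (prefix_rcons _ _).
      by rewrite eu prefix_prefix.
    move=> /(_ tS); rewrite size_rcons -(size_rcons u b) => hs.
    suff -> : rcons u b = t by [].
    by move: ht; rewrite prefixE take_oversize // => /eqP.
  move: ht; rewrite prefix_rconsE => /orP[ht|/eqP <-] //.
  have e : t = rcons u a.
    by apply: hS.1 => //; apply: prefix_trans ht (prefix_rcons _ _).
  by have := size_prefix ht; rewrite e size_rcons ltnn.
have Sub : S.[? rcons u b] = Some S.[ubS] by rewrite in_fnd.
rewrite Sub; congr Some; apply: cone_map_functional (hf _ _ Sub) _.
by rewrite -!cats1 eu -!catA; apply: cone_map_cat.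
Qed.

(** The right side depends on [f] alone, which gives uniqueness. Conversely, some code element is
    comparable with [x], and comparable maximal cones coincide. *)
Lemma unsimplifiable_symbolE (S : symbol n) f x y :
  maximal_prefix_code (domf S) -> ~ simplifiable S -> determines S f ->
  S.[? x] = Some y <-> maximal_cone f x y.
Proof.
move=> hS nsimp hf; have hmax := unsimplifiable_maximal_cone hS nsimp hf.
split=> [|[hxy hx]]; first exact: hmax.
have [t tS ht] := hS.2 x.
have St : S.[? t] = Some S.[tS] by rewrite in_fnd.
have [ct mt] := hmax _ _ St.
have e : t = x by case/orP: ht => [/(mt _ _ hxy)|/(hx _ _ ct)].
rewrite -e St; congr Some.
by apply: cone_map_functional ct _; rewrite e.
Qed.

(** Each code element of a given symbol is shortened to the root of a maximal cone containing its
    cone; the finitely many roots form the new code. *)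
Lemma unsimplifiable_symbol_exists f : in_T f -> exists S : symbol n,
  [/\ maximal_prefix_code (domf S), ~ simplifiable S & determines S f].
Proof.
move=> [S hS /(determinesP f hS) hf].
have rootP (t : domf S) : exists x, prefix x (val t) /\
    exists y, maximal_cone f x y.
  have [|x [y [px mx]]] := @maximal_cone_exists f (val t) S.[valP t].
    exact: hf (in_fnd (valP t)).
  by exists x; split=> //; exists y.
pose root t := projT1 (cid (rootP t)).
pose X := [fset root t | t : domf S].
have yP (x : X) : exists y, maximal_cone f (val x) y.
  by case/imfsetP: (valP x) => t _ ->; rewrite /root; case: cid => ? [].
pose S' : symbol n := [fmap x : X => projT1 (cid (yP x))].
have S'max x y : S'.[? x] = Some y -> maximal_cone f x y.
  move=> e; have xX : x \in X by rewrite -[X]/(domf S') -fndSome e.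
  by move: e; rewrite in_fnd ffunE => -[<-]; case: cid.
have hS' : maximal_prefix_code (domf S').
  split=> [x x' xX x'X|u] /=.
    have [cx _] := S'max _ _ (in_fnd (xX : x \in domf S')).
    have [_ mx'] := S'max _ _ (in_fnd (x'X : x' \in domf S')).
    exact: mx' cx.
  have [t tS ht] := hS.2 u.
  have rX : root [` tS] \in X by apply/imfsetP; exists [` tS].
  exists (root [` tS]) => //.
  have {rX} pr : prefix (root [` tS]) t.
    by rewrite /root; case: cid => ? [].
  case/orP: ht => [pu|pt]; last by rewrite (prefix_trans pr pt) orbT.
  (* Both [u] and the root are prefixes of [t], hence comparable. *)
  case: (leqP (size u) (size (root [` tS]))) => h.
    by rewrite (prefix_comparable pu pr).
  by rewrite (prefix_comparable pr pu) ?orbT // ltnW.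
exists S'; split=> //; last by apply/determinesP => // x y /S'max[].
move=> [u [y hu]]; have i0 := Ordinal n_gt1.
have [_ /(_ u y)] := S'max _ _ (hu i0).
(* The [n] pairs that could be merged make [f] act on all of the cone of [u], so [rcons u i0] is not
   prefix-minimal. *)
have cu : cone_map f u y.
  move=> w; rewrite -(ocons_odrop w).
  have [+ _] := S'max _ _ (hu (w 0)).
  by move=> /(_ (odrop 1 w)); rewrite -!cats1 !ocat_cat.
move=> /(_ cu (prefix_rcons _ _)) /(congr1 size).
by rewrite size_rcons => /n_Sn.
Qed.

Lemma standard_symbol_map_bij : bijective (@standard_symbol_map n).
Proof.
apply: inj_surj_bijective => [[S hS] [S' hS']|[f hf]].
  move=> /(congr1 (@proj1_sig _ _)) /= e; apply: sig_inj => /=.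
  have dS := symbol_funP (proj1 hS).
  have dS' := symbol_funP (proj1 hS'); rewrite -e in dS'.
  case: hS hS' {e} dS dS' => [mS nS] [mS' nS'] dS dS'.
  apply/fmapP => x.
  (* Both symbols list exactly the maximal cones of the same function. *)
  have key y : S.[? x] = Some y <-> S'.[? x] = Some y.
    by rewrite (unsimplifiable_symbolE _ _ mS nS dS)
               (unsimplifiable_symbolE _ _ mS' nS' dS').
  case e1: S.[? x] => [y|]; first by apply/esym/key.
  by case e2: S'.[? x] => [y|//]; move/key: e2; rewrite e1.
have [S [hS nS dS]] := unsimplifiable_symbol_exists hf.
exists (exist _ S (conj hS nS)); apply: sig_inj; apply/funext => v /=.
by apply/symbol_funP/dS.
Qed.

End Evaluation.

Theorem theorem5p25 (n : nat) (n_gt1 : 1 < n) :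
  exists phi : T_cantor_algebra n_gt1 -> standard_form_cantor_algebra n_gt1,
    cantor_isomorphism phi /\
    bijective (fun S : standard_symbol n => phi (standard_symbol_map S)).
Proof.
(* Evaluation goes from forms to maps, so [phi] is its inverse. *)
have [phi std_funK phiK] := std_fun_bij n_gt1; exists phi; split.
  apply: cantor_isomorphism_inverse std_funK phiK _; split.
  - exact: std_fun_bij.
  - exact: std_fun_alpha.
  - exact: std_fun_lambda.
apply: bij_comp (standard_symbol_map_bij n_gt1).
by exists (@std_fun n n_gt1).
Qed.
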